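(* Let $G$ be an abelian group, let $m,n$ be positive integers with $m\geq (\log n)^2$, let $Y\subset G$ with $|Y|=n$, and let $0<\epsilon<\frac{1}{4}$. Then there is a family $\mathcal{A}\subset 2^{Y+Y}\times 2^Y$ of pairs of sets $(A,B)$ with \[|\mathcal{A}|\leq \exp\Big(2^{16}\epsilon^{-2}\sqrt{m}(\log n)^{3/2}\Big)\] such that: (i) for every pair of sets $J\subset Y$, $I\subset Y+Y$ with $J+J\subset I$ and $|I|\leq m$, there is $(A,B)\in \mathcal{A}$ such that $A\subset I$ and $J\subset B$; (ii) for every $(A,B)\in \mathcal{A}$ we have $|A|\leq m$, and either $|B|\leq \frac{m}{\log n}$ or there are at most $\epsilon^2|B|^2$ ordered pairs $(b_1,b_2)\in B\times B$ such that $b_1+b_2\not \in A$.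
   Context: $Y+Y=\{a+b:a,b\in Y\}$; $\log$ is the natural logarithm. *)

(* Defs.v *)
From HB Require Import structures.
From mathcomp Require Import all_boot all_order all_algebra.
From Stdlib Require Import Reals.
Set Implicit Arguments. Unset Strict Implicit. Unset Printing Implicit Defensive.

(* Finite subsets of G are represented by sequences; membership is \in,
   cardinality is size (undup _). *)

Definition sumset (G : zmodType) (X Z : seq G) : seq G :=
  undup [seq GRing.add a b | a <- X, b <- Z].

Definition card_seq (G : eqType) (X : seq G) : nat := size (undup X).

Definition bad_pairs (G : zmodType) (A B : seq G) : nat :=
  size [seq pq <- [seq (b1, b2) | b1 <- undup B, b2 <- undup B]
          | GRing.add pq.1 pq.2 \notin A].

(* Main.v *)
Require Import Defs.
From HB Require Import structures.
From mathcomp Require Import all_boot all_order all_algebra.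
From Stdlib Require Import Reals Lra Lia.
From mathcomp Require Import zify.

(* Write L = log n.  Start from A = {}, B = Y and refine the pair while keeping
   A within I and J within B, by asking for elements of J.  If |B| > m / L and
   more than eps^2 |B|^2 pairs of B have their sum outside A, let H be the set of
   v in B with more than eps^2 |B| / 2 bad partners, and ask for t ~ sqrt(m / L)
   elements of J in H.  If there are fewer, everything else in H leaves B.
   Otherwise these elements form a set T, and J + T lies in I.  As long as some
   b in J has more than eps^2 t / 4 sums b + v, v in T, outside A, ask for such a
   b and add b + T to A; afterwards the remaining b of this kind are not in J and
   leave B.  Counting the bad pairs in T x B shows that the decrease of |B| plus
   the increase of |A| in a round is at least eps^2 |B| / 4.  As |A| <= m and
   |B| > m / L, there are O(L / eps^2) rounds, each with t questions, and in
   total O(m / (eps^2 t)) questions for an element b.  Each answer is one of at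
   most n + 1 possibilities, so there are at most
   (n + 1) ^ O(sqrt(m L) / eps^2) final pairs.  When sqrt(m / L) = O(1 / eps^2)
   the pairs (J + J, J) with |J| <= m are already few enough. *)

Set Implicit Arguments. Unset Strict Implicit. Unset Printing Implicit Defensive.

(** * Real estimates and double counting *)

Lemma INR_leq (a b : nat) : (a <= b)%N -> (INR a <= INR b)%R.
Proof. by move/leP; exact: le_INR. Qed.

Lemma nat_floor (x : R) : (0 <= x)%R -> exists h : nat, (INR h <= x < INR h + 1)%R.
Proof.
move=> x0; have [up_gt up_le] := archimed x.
have up_pos : (0 < up x)%Z by apply: lt_IZR; lra.
have [h hE] := IZN (up x - 1) ltac:(lia).
by exists h; rewrite INR_IZR_INZ -hE minus_IZR; lra.
Qed.

Lemma ln_le_sub1 (y : R) : (0 < y)%R -> (ln y <= y - 1)%R.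
Proof. by move=> y0; have := exp_ineq1_le (ln y); rewrite exp_ln //; lra. Qed.

(** Apply ln z <= z - 1 to z = (1 + y) / (1 + x) and use 1 + x <= 2x. Shrinking B thus lowers the
    logarithm in proportion to the relative loss. *)
Lemma ln_succ_drop (x y : R) : (1 <= x)%R -> (0 <= y <= x)%R ->
  (ln (1 + y) <= ln (1 + x) - (x - y) / (2 * x))%R.
Proof.
move=> x1 [y0 yx].
have inv0 : (0 < / (1 + x))%R by apply: Rinv_0_lt_compat; lra.
have -> : (1 + y = (1 + x) * ((1 + y) * / (1 + x)))%R by field; lra.
rewrite ln_mult; [|lra|by apply: Rmult_lt_0_compat; lra].
have := @ln_le_sub1 ((1 + y) * / (1 + x)) ltac:(apply: Rmult_lt_0_compat; lra).
have -> : ((1 + y) * / (1 + x) - 1 = - ((x - y) * / (1 + x)))%R by field; lra.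
have : (/ (2 * x) <= / (1 + x))%R by apply: Rinv_le_contravar; lra.
rewrite /Rdiv; nra.
Qed.

Lemma sum_leq_threshold (T : Type) (f : T -> nat) (s : seq T) (h N : nat) :
  (forall x, f x <= N)%N ->
  (\sum_(x <- s) f x <= count (fun x => h < f x) s * N + size s * h)%N.
Proof.
move=> fN; elim: s => [|x s IHs]; first by rewrite big_nil.
rewrite big_cons /= mulnDl mulSn addnACA.
apply: leq_add IHs; case: ltnP => hx; last by rewrite mul0n add0n.
by rewrite mul1n (leq_trans (fN x)) ?leq_addr.
Qed.

Lemma sum_count_exchange (S T : Type) (r : S -> T -> bool) (s : seq S) (t : seq T) :
  \sum_(x <- s) count (r x) t = \sum_(y <- t) count (r^~ y) s.
Proof.
have E (U : Type) (p : U -> bool) u : count p u = \sum_(x <- u) (p x : nat).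
  by rewrite -sum1_count big_mkcond; apply: eq_bigr => x _; case: (p x).
under eq_bigr do rewrite E; rewrite exchange_big /=.
by apply: eq_bigr => y _; rewrite E.
Qed.

(** * Bad degrees and their change when A grows and B shrinks *)

Section Degree.
Variable G : zmodType.
Implicit Types A B T X : seq G.

Definition bad_degree A X (v : G) : nat :=
  count (fun x => GRing.add v x \notin A) X.

Lemma bad_degree_le_size A X v : (bad_degree A X v <= size X)%N.
Proof. exact: count_size. Qed.

Lemma bad_pairsE A B : uniq B ->
  bad_pairs A B = \sum_(v <- B) bad_degree A B v.
Proof.
move=> uB; rewrite /bad_pairs undup_id // size_filter.
have E s : count (fun pq : G * G => GRing.add pq.1 pq.2 \notin A)
    [seq (b1, b2) | b1 <- s, b2 <- B] = \sum_(v <- s) bad_degree A B v.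
  elim: s => [|b s IHs]; first by rewrite big_nil.
  by rewrite big_cons /= count_cat IHs count_map.
exact: E.
Qed.

Lemma sum_bad_degreeC A X Z :
  \sum_(v <- X) bad_degree A Z v = \sum_(v <- Z) bad_degree A X v.
Proof.
rewrite /bad_degree (sum_count_exchange (fun v x => GRing.add v x \notin A)).
by apply: eq_bigr => y _; apply: eq_count => x; rewrite GRing.addrC.
Qed.

(** A bad partner b of v is either dropped by [P], or still bad for A', or has v + b in A' but not
    in A. Since b -> v + b is injective, the last kind numbers at most |A'| - |A|. *)
Lemma bad_degree_update A A' B (P : pred G) v :
  uniq A -> uniq A' -> uniq B -> {subset A <= A'} ->
  (bad_degree A B v + count P B + size A <=
   size B + bad_degree A' [seq b <- B | P b] v + size A')%N.
Proof.
move=> uA uA' uB sAA'.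
pose new := [seq b <- B | (GRing.add v b \in A') && (GRing.add v b \notin A)].
have new_le : (size new + size A <= size A')%N.
  rewrite -(size_map (GRing.add v) new) -size_cat; apply: uniq_leq_size.
    rewrite cat_uniq uA (map_inj_uniq (@GRing.addrI _ v)) filter_uniq // andbT /=.
    apply/hasPn => x xA; apply/mapP => -[b]; rewrite mem_filter => /andP[/andP[_ bA] _] xE.
    by rewrite -xE xA in bA.
  move=> x; rewrite mem_cat => /orP[/mapP[b]|/sAA' //].
  by rewrite mem_filter => /andP[/andP[? _] _] ->.
have deg_le : (bad_degree A B v + count P B <=
    size B + bad_degree A' [seq b <- B | P b] v + size new)%N.
  rewrite /bad_degree count_filter /new size_filter {uB new new_le}.
  elim: B => //= b B IHB.
  have := sAA' (GRing.add v b).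
  case: (P b); case: (GRing.add v b \in A); case: (GRing.add v b \in A') => //= sb;
    try (by have := sb isT); lia.
by lia.
Qed.

(** The previous bound summed over T; the surviving bad pairs are counted from the side of B, where
    each kept b has at most h of them. *)
Lemma sum_bad_degree_update A A' B T (P : pred G) h :
  uniq A -> uniq A' -> uniq B -> {subset A <= A'} ->
  (forall b, b \in B -> P b -> bad_degree A' T b <= h)%N ->
  (\sum_(v <- T) bad_degree A B v + size T * (count P B + size A) <=
   size T * (size B + size A') + count P B * h)%N.
Proof.
move=> uA uA' uB sAA' Ph.
have clean : (\sum_(v <- T) bad_degree A' [seq b <- B | P b] v <= count P B * h)%N.
  rewrite sum_bad_degreeC -size_filter -sum1_size big_distrl /= !big_seq.
  apply: leq_sum => b; rewrite mem_filter mul1n => /andP[Pb bB]; exact: Ph.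
have step v := bad_degree_update P v uA uA' uB sAA'.
suff: (\sum_(v <- T) bad_degree A B v + size T * (count P B + size A) <=
    size T * (size B + size A') + \sum_(v <- T) bad_degree A' [seq b <- B | P b] v)%N.
  by move=> /leq_trans; apply; rewrite leq_add2l.
elim: {clean Ph}T => [|v T IHT]; first by rewrite !big_nil.
rewrite !big_cons /= !mulSn; have := step v; lia.
Qed.

End Degree.

(** * Container families built by adaptive questions about J *)

Section Containers.
Variables (G : zmodType) (Y : seq G) (m : nat) (L e : R).
Implicit Types (A B H I J T : seq G) (P Q : seq G -> seq G -> Prop).

Definition admissible J I : Prop :=
  [/\ {subset J <= Y}, {subset I <= sumset Y Y}, {subset sumset J J <= I}
    & (card_seq I <= m)%N].

Definition good_container (p : seq G * seq G) : Prop :=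
  [/\ {subset p.1 <= sumset Y Y}, {subset p.2 <= Y}, (card_seq p.1 <= m)%N
    & (INR (card_seq p.2) * L <= INR m)%R \/
      (INR (bad_pairs p.1 p.2) <= e * INR (card_seq p.2) ^ 2)%R].

(** The family lists the leaves of a decision tree of depth k in which every question has at most
    |Y| + 1 answers; [P] records what is known of (J, I) so far. *)
Definition coverable P (k : nat) : Prop :=
  exists F : seq (seq G * seq G),
    [/\ (size F <= expn (size Y).+1 k)%N, forall p, p \in F -> good_container p
      & forall J I, admissible J I -> P J I ->
          exists p, p \in F /\ {subset p.1 <= I} /\ {subset J <= p.2}].

Definition fits A B J I : Prop := {subset J <= B} /\ {subset A <= I}.

Lemma mem_sumset J (x y : G) : x \in J -> y \in J -> GRing.add x y \in sumset J J.
Proof. by move=> xJ yJ; rewrite mem_undup; apply/allpairsP; exists (x, y). Qed.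

Lemma fits_card_le A B J I : uniq A -> admissible J I -> fits A B J I -> (size A <= m)%N.
Proof.
move=> uA [_ _ _ cI] [_ sAI]; apply: leq_trans cI.
by apply: uniq_leq_size => // x /sAI; rewrite mem_undup.
Qed.

(** For x in J the translate x + J lies in J + J, hence in I. *)
Lemma admissible_card_le J I : uniq J -> admissible J I -> (size J <= m)%N.
Proof.
case: J => // x J uJ [_ _ sJI cI]; apply: leq_trans cI.
rewrite -(size_map (GRing.add x) (x :: J)); apply: uniq_leq_size.
  by rewrite map_inj_uniq //; exact: GRing.addrI.
move=> _ /mapP[y yJ ->]; rewrite mem_undup; apply: sJI.
by apply: mem_sumset; rewrite ?mem_head.
Qed.

Lemma coverable_weaken P P' k k' :
  (forall J I, admissible J I -> P' J I -> P J I) -> (k <= k')%N ->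
  coverable P k -> coverable P' k'.
Proof.
move=> PP' kk' [F [sF gF cF]]; exists F; split=> //.
  by rewrite (leq_trans sF) // leq_pexp2l.
by move=> J I aJI /(PP' _ _ aJI); exact: cF.
Qed.

Lemma coverable_empty P k : (forall J I, admissible J I -> ~ P J I) -> coverable P k.
Proof. by move=> nP; exists [::]; split=> // J I /nP. Qed.

(** The single pair (A, B) suffices, unless A is too large or leaves Y + Y; then no admissible (J,
    I) fits and the empty family works. *)
Lemma coverable_leaf A B k :
  uniq A -> {subset B <= Y} ->
  (INR (card_seq B) * L <= INR m)%R \/
    (INR (bad_pairs A B) <= e * INR (card_seq B) ^ 2)%R ->
  coverable (fits A B) k.
Proof.
move=> uA sBY dich.
case: (boolP ((size A <= m)%N && all (mem (sumset Y Y)) A)) => [/andP[Am /allP sA]|nA].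
  exists [:: (A, B)]; split; first by rewrite /= expn_gt0.
    by move=> p; rewrite inE => /eqP ->; split=> //=; rewrite /card_seq undup_id.
  by move=> J I _ [sJB sAI]; exists (A, B); rewrite inE.
apply: coverable_empty => J I aJI fJI; case/negP: nA; apply/andP; split.
  exact: fits_card_le fJI.
by apply/allP => x /(proj2 fJI); case: aJI => _ sI _ _ /sI.
Qed.

Lemma coverable_branch (X : eqType) (C : seq X) (Q : X -> seq G -> seq G -> Prop) P k :
  (size C <= (size Y).+1)%N -> (forall x, x \in C -> coverable (Q x) k) ->
  (forall J I, admissible J I -> P J I -> exists2 x, x \in C & Q x J I) ->
  coverable P k.+1.
Proof.
move=> sC covQ PQ.
suff [F [sF gF cF]] : exists F : seq (seq G * seq G),
    [/\ (size F <= size C * expn (size Y).+1 k)%N,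
        forall p, p \in F -> good_container p
      & forall x J I, x \in C -> admissible J I -> Q x J I ->
          exists p, p \in F /\ {subset p.1 <= I} /\ {subset J <= p.2}].
  exists F; split=> //; first by rewrite (leq_trans sF) // expnS leq_mul2r sC orbT.
  by move=> J I aJI /(PQ _ _ aJI)[x xC QJI]; exact: cF QJI.
elim: C covQ {sC PQ} => [|x C IHC] covQ; first by exists [::].
have [|F [sF gF cF]] := IHC; first by move=> y yC; apply: covQ; rewrite inE yC orbT.
have [F' [sF' gF' cF']] := covQ x (mem_head _ _).
exists (F' ++ F); split.
- by rewrite size_cat /= mulSn leq_add.
- by move=> p; rewrite mem_cat => /orP[/gF'|/gF].
- move=> y J I; rewrite inE => /predU1P[->|yC] aJI QJI.
    by have [p [pF pP]] := cF' _ _ aJI QJI; exists p; rewrite mem_cat pF.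
  by have [p [pF pP]] := cF _ _ _ yC aJI QJI; exists p; rewrite mem_cat pF orbT.
Qed.

(* Asking for one more element of J in H has at most |Y| + 1 answers. *)
Lemma coverable_query H P k :
  uniq H -> {subset H <= Y} ->
  coverable (fun J I => P J I /\ {in J, forall x, x \notin H}) k ->
  (forall x, x \in H -> coverable (fun J I => P J I /\ x \in J) k) ->
  coverable P k.+1.
Proof.
move=> uH sHY cov0 cov1.
pose C := None :: map Some H.
pose R o J I := P J I /\ if o is Some x then x \in J : Prop else {in J, forall x, x \notin H}.
apply: (@coverable_branch _ C R); first by rewrite /= size_map ltnS uniq_leq_size.
  by case=> [x|] //; rewrite inE /= => /mapP[y yH [->]]; exact: cov1.
move=> J I aJI PJI; case: (boolP (has (mem H) J)) => [/hasP[x xJ xH]|/hasPn nH].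
  by exists (Some x); rewrite ?inE ?map_f.
by exists None.
Qed.

(** Ask repeatedly for an element of J in H outside the current T. Either t elements are found, or
    the search stops early with J and H meeting only inside T. *)
Lemma coverable_collect H P t k :
  uniq H -> {subset H <= Y} ->
  (forall T, uniq T -> size T = t -> {subset T <= H} ->
     coverable (fun J I => P J I /\ {subset T <= J}) k) ->
  (forall T, uniq T -> (size T < t)%N -> {subset T <= H} ->
     coverable (fun J I => P J I /\ {subset T <= J} /\
                           {in J, forall x, x \in H -> x \in T}) k) ->
  coverable P (k + t).
Proof.
move=> uH sHY covF covS.
have main i : forall T, uniq T -> {subset T <= H} -> (size T + i)%N = t ->
    coverable (fun J I => P J I /\ {subset T <= J}) (k + i).
  elim: i => [|i IHi] T uT sTH sT; first by rewrite addn0; apply: covF; rewrite -?sT ?addn0.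
  rewrite addnS; apply: (@coverable_query [seq x <- H | x \notin T]).
  - by rewrite filter_uniq.
  - by move=> x; rewrite mem_filter => /andP[_ /sHY].
  - apply: coverable_weaken (leq_addr i k) (covS T uT _ sTH); last by lia.
    move=> J I _ [[PJI sTJ] nH]; do 2!split=> //.
    by move=> x /nH; rewrite mem_filter => + xH; rewrite xH andbT negbK.
  - move=> x; rewrite mem_filter => /andP[xT xH].
    apply: coverable_weaken (leqnn _) (IHi (x :: T) _ _ _) => /=.
    + by move=> J I _ [[PJI sTJ] xJ]; split=> // y; rewrite inE => /predU1P[->|/sTJ].
    + by rewrite xT.
    + by move=> y; rewrite inE => /predU1P[->|/sTH].
    + by lia.
by apply: coverable_weaken (leqnn _) (main t [::] _ _ _).
Qed.

(* An element b of J with many bad sums b + v, v in T, adds all of them to A;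
   the elements of B that still have many bad sums when no such b is left are
   not in J. *)
Lemma coverable_saturate A0 B T h (c q : R) :
  (0 <= q)%R -> (1 <= c * INR h.+1)%R -> uniq T -> uniq B -> {subset B <= Y} ->
  (forall A k, uniq A -> {subset A0 <= A} -> (q + c * (INR m - INR (size A)) <= INR k)%R ->
     coverable (fits A [seq b <- B | bad_degree A T b <= h]%N) k) ->
  forall A k, uniq A -> {subset A0 <= A} ->
    (q + c * (INR m - INR (size A)) <= INR k)%R ->
    coverable (fun J I => fits A B J I /\ {subset T <= J}) k.+1.
Proof.
move=> q0 c1 uT uB sBY covC A k.
have c0 : (0 < c)%R.
  have := pos_INR h.+1; case: (Rlt_le_dec 0 c) => // ? ?; nra.
(* Each positive answer strictly enlarges A, so m + 1 - |A| decreases. *)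
have [g] := ubnP (m.+1 - size A); elim: g A k => // g IHg A k sg uA sA Ak.
case: (leqP (size A) m) => [Am|mA]; last first.
  by apply: coverable_empty => J I aJI [/(fits_card_le uA aJI)]; lia.
apply: (@coverable_query [seq b <- B | (h < bad_degree A T b)%N]).
- by rewrite filter_uniq.
- by move=> b; rewrite mem_filter => /andP[_ /sBY].
- apply: coverable_weaken (leqnn _) (covC A k uA sA Ak).
  move=> J I _ [[[sJB sAI] _] nJ]; split=> // b bJ.
  by have := nJ b bJ; rewrite !mem_filter (sJB b bJ) !andbT -leqNgt.
move=> b; rewrite mem_filter => /andP[hb bB].
pose A' := A ++ [seq x <- map (GRing.add b) T | x \notin A].
have sA' : size A' = (size A + bad_degree A T b)%N.
  by rewrite size_cat size_filter count_map.
have uA' : uniq A'.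
  rewrite cat_uniq uA filter_uniq ?map_inj_uniq // ?andbT; last exact: GRing.addrI.
  by apply/hasPn => x; rewrite mem_filter => /andP[].
have fit' J I : admissible J I ->
    (fits A B J I /\ {subset T <= J}) /\ b \in J -> fits A' B J I /\ {subset T <= J}.
  move=> [_ _ sJI _] [[[sJB sAI] sTJ] bJ]; split=> //; split=> // x.
  rewrite mem_cat mem_filter => /orP[/sAI //|/andP[_ /mapP[v /sTJ vJ ->]]].
  by apply: sJI; exact: mem_sumset.
case: (leqP (size A') m) => [A'm|mA']; last first.
  by apply: coverable_empty => J I aJI /(fit' _ _ aJI)[/(fits_card_le uA' aJI)]; lia.
have A'k : (q + c * (INR m - INR (size A')) <= INR k - 1)%R.
  have := INR_leq hb; rewrite sA' plus_INR => ?; nra.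
(* The budget cannot be exhausted here: q >= 0 and |A'| <= m rule out k = 0. *)
case: k Ak A'k => [|k] Ak A'k.
  have := INR_leq A'm; move: A'k; rewrite /=; nra.
apply: coverable_weaken fit' (leqnn _) (IHg A' k _ uA' _ _).
- by rewrite sA'; lia.
- by move=> x /sA; rewrite mem_cat => ->.
- by rewrite S_INR in A'k; lra.
Qed.


(** * The potential bounding the number of questions *)

Section Potential.
Variables (t : nat).
Hypotheses (L_gt0 : (0 < L)%R) (e_bounds : (0 < e <= 1)%R) (t_gt0 : (0 < t)%N).
Hypothesis t_small : (4 * INR t * L <= e * INR m)%R.

(** [a] makes a / (2x) times a drop of e x / 4 equal to t + 1; [c] is the value of a / (2x) at x = m
    / L; [d] is the price per element when one question adds more than e t / 4 elements to A. *)
Let a : R := (8 * (INR t + 1) / e)%R.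
Let c : R := (a * L / (2 * INR m))%R.
Let d : R := (4 / (e * INR t))%R.

(* x = |B| and y = |A|; the terms in a and c pay for the t + 1 questions of a
   round, the term in d for the questions that enlarge A. *)
Definition potential (x y : R) : R := (a * ln (1 + x) + (c + d) * (INR m - y))%R.

Let m_gt0 : (0 < INR m)%R.
Proof. by have := INR_leq t_gt0; rewrite /= => ?; nra. Qed.

Let a_gt0 : (0 < a)%R.
Proof.
have := pos_INR t => ?; rewrite /a /Rdiv.
by apply: Rmult_lt_0_compat; [lra|apply: Rinv_0_lt_compat; lra].
Qed.

Let a_e : (a * e = 8 * (INR t + 1))%R.
Proof. by rewrite /a; field; lra. Qed.

Let c_gt0 : (0 < c)%R.
Proof.
rewrite /c /Rdiv; apply: Rmult_lt_0_compat; first exact: Rmult_lt_0_compat.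
by apply: Rinv_0_lt_compat; lra.
Qed.

Let d_gt0 : (0 < d)%R.
Proof.
have := INR_leq t_gt0; rewrite /= => ?; rewrite /d /Rdiv.
by apply: Rmult_lt_0_compat; [lra|apply: Rinv_0_lt_compat; nra].
Qed.

(** Since x > m / L, one has c >= a / (2x), so each element lost by B or gained by A lowers this sum
    by at least a / (2x); together they pay for t + 1 questions. *)
Lemma round_drop (x x' y y' : R) :
  (1 <= x)%R -> (0 <= x' <= x)%R -> (y <= y')%R -> (INR m < x * L)%R ->
  (e * x / 4 <= (x - x') + (y' - y))%R ->
  (a * ln (1 + x') + c * (INR m - y') + (INR t + 1) <= a * ln (1 + x) + c * (INR m - y))%R.
Proof.
move=> x1 x'x yy' mx drop.
have c_ge : (a * / (2 * x) <= c)%R.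
  rewrite /c /Rdiv Rmult_assoc; apply: Rmult_le_compat_l; first lra.
  have -> : (L * / (2 * INR m) = / (2 * INR m * / L))%R by field; lra.
  apply: Rinv_le_contravar; first by apply: Rmult_lt_0_compat; [lra|exact: Rinv_0_lt_compat].
  have -> : (2 * x = 2 * (x * L) * / L)%R by field; lra.
  by apply: Rmult_le_compat_r; [left; exact: Rinv_0_lt_compat|lra].
have ln_le := ln_succ_drop x1 x'x.
have a_ln : (a * ln (1 + x') <= a * ln (1 + x) - a * / (2 * x) * (x - x'))%R.
  by move: ln_le; rewrite /Rdiv; nra.
have gain : (INR t + 1 <= a * / (2 * x) * ((x - x') + (y' - y)))%R.
  apply: Rle_trans (Rmult_le_compat_l _ _ _ _ drop); last first.
    by apply: Rmult_le_pos; [lra|left; apply: Rinv_0_lt_compat; lra].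
  have -> : (a * / (2 * x) * (e * x / 4) = a * e / 8)%R by field; lra.
  by rewrite a_e; lra.
by nra.
Qed.

Lemma coverable_potential k A B :
  uniq A -> uniq B -> {subset B <= Y} ->
  (potential (INR (size B)) (INR (size A)) <= INR k)%R -> coverable (fits A B) k.
Proof.
have [K] := ubnP k; elim: K k A B => // K IHK k A B kK uA uB sBY pot.
case: (leqP (size A) m) => [Am|mA]; last first.
  by apply: coverable_empty => J I aJI /(fits_card_le uA aJI); lia.
have cB : card_seq B = size B by rewrite /card_seq undup_id.
case: (Rle_lt_dec (INR (card_seq B) * L) (INR m)) => [small|large].
  by apply: coverable_leaf => //; left.
case: (Rle_lt_dec (INR (bad_pairs A B)) (e * INR (card_seq B) ^ 2)) => [few|many].
  by apply: coverable_leaf => //; right.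
rewrite cB in large many; set b := INR (size B) in large many pot.
have AmR := INR_leq Am.
have t1 : (1 <= INR t)%R by have := INR_leq t_gt0.
have b1 : (1 <= b)%R.
  have [B0|] := posnP (size B); last by move/INR_leq.
  by move: large; rewrite /b B0 /=; lra.
have [h [h_le h_gt]] : exists h : nat, (INR h <= e * b / 2 < INR h + 1)%R.
  by apply: nat_floor; nra.
have [g [g_le g_gt]] : exists g : nat, (INR g <= e * INR t / 4 < INR g + 1)%R.
  by apply: nat_floor; nra.
pose H := [seq v <- B | h < bad_degree A B v]%N.
(* Elements outside H account for at most b * (e b / 2) of the more than e b^2 bad pairs, and each
   element of H for at most b. *)
have high_card : (e * b / 2 <= INR (size H))%R.
  have := INR_leq (sum_leq_threshold B h (bad_degree_le_size A B)).
  rewrite -bad_pairsE // -size_filter -/H plus_INR !mult_INR -/b => le_sum.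
  have : (e * b ^ 2 < INR (size H) * b + b * (e * b / 2))%R by nra.
  by nra.
have t_b : (INR t <= e * b / 4)%R by nra.
(* The logarithmic term alone pays for this round: ln (1 + b) > 1/2 and a >= a e = 8 (t + 1). *)
have q_pos : (0 <= a * ln (1 + b) + c * (INR m - INR (size A)) - (INR t + 1))%R.
  have : (/ 2 < ln (1 + b))%R.
    apply: Rlt_le_trans ln_lt_2 _; case: (Rle_lt_or_eq_dec _ _ b1) => [b1'|<-].
      by left; apply: ln_increasing; lra.
    by right; congr ln; lra.
  have : (a * e <= a)%R by nra.
  rewrite a_e => ? ?; nra.
have potE x y : potential x y = (a * ln (1 + x) + c * (INR m - y) + d * (INR m - y))%R.
  by rewrite /potential; ring.
set q := (_ - _)%R in q_pos.
have pot_q : (q + d * (INR m - INR (size A)) + (INR t + 1) <= INR k)%R.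
  by move: pot; rewrite potE /q; lra.
(* t questions collect T; the extra one is the final negative answer of the saturation. *)
have [k0 kE] : exists k0, k = (k0.+1 + t)%N.
  exists (k - t.+1)%N; have : (t.+1 <= k)%N.
    have dA : (0 <= d * (INR m - INR (size A)))%R by apply: Rmult_le_pos; lra.
    by apply/leP; apply: INR_le; rewrite S_INR; lra.
  by lia.
have pot_k0 : (q + d * (INR m - INR (size A)) <= INR k0)%R.
  by move: pot_q; rewrite kE plus_INR S_INR; lra.
have IH A' B' k' : (k' <= k0)%N -> uniq A' -> uniq B' -> {subset B' <= Y} ->
    (potential (INR (size B')) (INR (size A')) <= INR k')%R -> coverable (fits A' B') k'.
  by move=> ?; apply: IHK; lia.
rewrite kE; apply: (@coverable_collect H); first by rewrite filter_uniq.
- by move=> x; rewrite mem_filter => /andP[_ /sBY].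
- move=> T uT sT sTH.
  have d_g : (1 <= d * INR g.+1)%R.
    rewrite S_INR /d.
    have {1}-> : (1 = 4 / (e * INR t) * (e * INR t / 4))%R by field; lra.
    by apply: Rmult_le_compat_l; [left|lra].
  apply: (@coverable_saturate A B T g d q q_pos d_g uT uB sBY _ A k0 uA _ pot_k0) => //.
  move=> A' k' uA' sAA' pot'.
  (* The budget k' is arbitrary, while the induction needs one of at most k0; capping is harmless
     because |A| <= |A'|. *)
  pose k1 := minn k' k0.
  have sA'R : (INR (size A) <= INR (size A'))%R by exact: INR_leq (uniq_leq_size uA sAA').
  have pot1 : (q + d * (INR m - INR (size A')) <= INR k1)%R.
    have : (d * (INR m - INR (size A')) <= d * (INR m - INR (size A)))%R.
      by apply: Rmult_le_compat_l; lra.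
    by rewrite /k1 /minn; case: ifP => _ ?; lra.
  apply: (coverable_weaken (P := fits A' [seq b <- B | bad_degree A' T b <= g]%N) (k := k1)) => //.
    exact: geq_minl.
  apply: IH => //; first exact: geq_minr.
  + by rewrite filter_uniq.
  + by move=> x; rewrite mem_filter => /andP[_ /sBY].
  rewrite potE; apply: Rle_trans pot1; apply: Rplus_le_compat_r.
  pose P := (fun x => bad_degree A' T x <= g)%N.
  have countB : (count P B <= size B)%N by exact: count_size.
  have /INR_leq := sum_bad_degree_update (P := P) (h := g) (T := T) uA uA' uB sAA' (fun _ _ Pb => Pb).
  (* Bad pairs in T x B: at least t (h + 1) before the round, while the kept part of B carries at
     most b' g <= b e t / 4 after it. Dividing by t leaves a drop of at least e b / 4. *)
  have /INR_leq : (size T * h.+1 <= \sum_(v <- T) bad_degree A B v)%N.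
    rewrite -sum1_size big_distrl /= !big_seq; apply: leq_sum => v /sTH.
    by rewrite mem_filter mul1n => /andP[].
  rewrite size_filter sT !(plus_INR, mult_INR) S_INR -/b.
  move: (INR_leq countB) (pos_INR (count P B)); rewrite -/b -/P.
  set b' := INR (count P B) => b'b b'0 low upd.
  suff: (a * ln (1 + b') + c * (INR m - INR (size A')) + (INR t + 1) <=
         a * ln (1 + b) + c * (INR m - INR (size A)))%R by rewrite /q; lra.
  apply: round_drop => //.
  have clean_le : (b' * INR g <= b * (e * INR t / 4))%R.
    by apply: Rmult_le_compat => //; exact: pos_INR.
  apply: (Rmult_le_reg_l (INR t)); first lra.
  have : (INR t * (e * b / 2) <= INR t * (INR h + 1))%R by apply: Rmult_le_compat_l; lra.
  by lra.
- move=> T uT sT sTH.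
  (* Early stop: B loses H except T, at least e b / 2 - t >= e b / 4 elements. *)
  pose B' := [seq v <- B | bad_degree A B v <= h]%N ++ T.
  have sB' : (INR (size B') + e * b / 4 <= b)%R.
    have : (size H + size [seq v <- B | bad_degree A B v <= h]%N = size B)%N.
      rewrite !size_filter -(count_predC (fun v => h < bad_degree A B v)%N B).
      by congr addn; apply: eq_count => v /=; rewrite -leqNgt.
    move/(congr1 INR); rewrite /B' size_cat !plus_INR -/b.
    have := INR_leq (ltnW sT); lra.
  apply: (coverable_weaken (P := fits A B') (k := k0)) => //.
    move=> J I _ [[sJB sAI] [_ nH]]; split=> // x xJ.
    have := nH x xJ; rewrite mem_cat !mem_filter (sJB x xJ) !andbT.
    by case: ltnP => //= _ ->.
  apply: IH => //.
  + rewrite cat_uniq filter_uniq // uT andbT /=; apply/hasPn => x /sTH.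
    by rewrite !mem_filter => /andP[hx _]; rewrite leqNgt hx.
  + by move=> x; rewrite mem_cat mem_filter => /orP[/andP[_ /sBY]|/sTH] //; rewrite mem_filter => /andP[_ /sBY].
  rewrite potE; apply: Rle_trans pot_k0; apply: Rplus_le_compat_r.
  suff: (a * ln (1 + INR (size B')) + c * (INR m - INR (size A)) + (INR t + 1) <=
         a * ln (1 + b) + c * (INR m - INR (size A)))%R by rewrite /q; lra.
  by apply: round_drop => //; have := pos_INR (size B'); first split; nra.
Qed.

End Potential.

(** Collecting m + 1 elements of J is impossible as |J| <= m, so the search stops with T = J, and (T
    + T, T) has no bad pairs. *)
Lemma coverable_all_sets : uniq Y -> (0 <= e)%R -> coverable (fun _ _ => True) m.+1.
Proof.
move=> uY e0; rewrite -[m.+1]add0n; apply: (@coverable_collect Y) => // T uT sT sTY.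
  apply: coverable_empty => J I aJI [_ sTJ].
  suff: (size T <= m)%N by rewrite sT ltnn.
  case: aJI => _ sIY sJI cI; apply: (@admissible_card_le T I) => //; split=> // x.
  rewrite mem_undup => /allpairsP[[y z] [/= /sTJ yJ /sTJ zJ ->]].
  by apply: sJI; exact: mem_sumset.
apply: (coverable_weaken (P := fits (sumset T T) T) (k := 0)) => //.
  move=> J I [sJY _ sJI _] [_ [sTJ sJT]]; split; first by move=> x xJ; exact: sJT (sJY x xJ).
  move=> x; rewrite mem_undup => /allpairsP[[y z] [/= /sTJ yJ /sTJ zJ ->]].
  by apply: sJI; exact: mem_sumset.
apply: coverable_leaf => //; first exact: undup_uniq.
right; suff -> : bad_pairs (sumset T T) T = 0%N.
  by apply: Rmult_le_pos => //; exact: pow2_ge_0.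
rewrite bad_pairsE // big_seq big1 // => v vT; apply/eqP.
rewrite -leqn0 leqNgt -has_count; apply/hasPn => x xT.
by rewrite negbK mem_sumset.
Qed.

End Containers.

(** * Exponential form of the bound and choice of parameters *)

Lemma ln_succ_le_double (n : nat) : (1 < n)%N -> (ln (INR n.+1) <= 2 * ln (INR n))%R.
Proof.
move=> n1; have n2 : (2 <= INR n)%R by exact: INR_leq n1.
rewrite S_INR.
have -> : (2 * ln (INR n) = ln (INR n * INR n))%R by rewrite ln_mult; lra.
have : (INR n + 1 <= INR n * INR n)%R by nra.
by case=> [lt|->]; [left; apply: ln_increasing; lra|right].
Qed.

Lemma INR_expn (n k : nat) : INR (expn n k) = (INR n ^ k)%R.
Proof. by elim: k => [|k IHk]; rewrite ?expn0 // expnS mult_INR IHk. Qed.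

Lemma expn_le_exp (n k : nat) (x : R) :
  (1 < n)%N -> (2 * INR k * ln (INR n) <= x)%R -> (INR (expn n.+1 k) <= exp x)%R.
Proof.
move=> n1 kx; have n0 : (0 < INR n.+1)%R by rewrite S_INR; have := pos_INR n; lra.
have -> : INR (expn n.+1 k) = exp (INR k * ln (INR n.+1))%R.
  by rewrite INR_expn -[X in (X ^ _)%R](exp_ln _ n0) -Rpower_pow ?/Rpower ?ln_exp //; exact: exp_pos.
have : (INR k * ln (INR n.+1) <= x)%R.
  apply: Rle_trans kx; have := Rmult_le_compat_l _ _ _ (pos_INR k) (ln_succ_le_double n1).
  by lra.
by case=> [lt|->]; [left; exact: exp_increasing|right].
Qed.

Theorem theorem4p2 (G : zmodType) (m n : nat) (Y : seq G) (eps : R) :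
  (0 < m)%N -> (0 < n)%N ->
  (ln (INR n) ^ 2 <= INR m)%R ->
  uniq Y -> size Y = n ->
  (0 < eps < 1 / 4)%R ->
  exists F : seq (seq G * seq G),
    (INR (size F) <=
       exp (2 ^ 16 * / eps ^ 2 * sqrt (INR m) * (ln (INR n) * sqrt (ln (INR n)))))%R /\
    (forall p, p \in F -> {subset p.1 <= sumset Y Y} /\ {subset p.2 <= Y}) /\
    (forall J I : seq G,
        {subset J <= Y} -> {subset I <= sumset Y Y} ->
        {subset sumset J J <= I} -> (card_seq I <= m)%N ->
        exists p, p \in F /\ {subset p.1 <= I} /\ {subset J <= p.2}) /\
    (forall p, p \in F ->
        (card_seq p.1 <= m)%N /\
        ((INR (card_seq p.2) * ln (INR n) <= INR m)%R \/
         (INR (bad_pairs p.1 p.2) <= eps ^ 2 * INR (card_seq p.2) ^ 2)%R)).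
Proof.
move=> m0 n0 Lm uY sY epsb.
have [n1|n1] := leqP n 1.
  (* Here log n = 0, so only one pair is allowed, and every B satisfies the first alternative. *)
  have -> : n = 1%N by lia.
  exists [:: ([::], Y)]; rewrite /= ln_1 !Rmult_0_l Rmult_0_r exp_0; split; first lra.
  split; first by move=> p; rewrite inE => /eqP ->; split.
  split; first by move=> J I sJ _ _ _; exists ([::], Y); rewrite inE eqxx.
  move=> p; rewrite inE => /eqP -> /=; split=> //; left.
  by rewrite Rmult_0_r; exact: pos_INR.
set L := ln (INR n) in Lm *; set M := INR m in Lm *; set e := (eps ^ 2)%R.
have e0 : (0 < e)%R by rewrite /e; nra.
have e1 : (e <= 1 / 16)%R by rewrite /e; nra.
have L_gt : (/ 2 < L)%R.
  apply: Rlt_le_trans ln_lt_2 _; have n2 : (2 <= INR n)%R by exact: INR_leq n1.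
  by rewrite /L; case: n2 => [lt|<-]; [left; apply: ln_increasing; lra|lra].
have M1 : (1 <= M)%R by have := INR_leq m0.
set s := sqrt M; set l := sqrt L.
have s1 : (0 < s)%R by apply: sqrt_lt_R0; lra.
have l1 : (0 < l)%R by apply: sqrt_lt_R0; lra.
have ss : (s * s = M)%R by apply: sqrt_sqrt; lra.
have ll : (l * l = L)%R by apply: sqrt_sqrt; lra.
suff [k [k_le [F [sF gF cF]]]] : exists k,
    (2 * INR k * L <= 2 ^ 16 * / e * s * (L * l))%R /\
    coverable Y m L e (fun _ _ => True) k.
  exists F; split.
    apply: Rle_trans (INR_leq sF) _; rewrite sY; exact: expn_le_exp.
  split; first by move=> p /gF[].
  split; first by move=> J I sJY sIY sJI cI; exact: cF.
  by move=> p /gF[].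
(* r = sqrt (m / L) is the number of elements collected in one round. *)
pose r := (s / l)%R.
have rl : (r * l = s)%R by rewrite /r; field; lra.
have r0 : (0 < r)%R by apply: Rdiv_lt_0_compat.
have ie : (16 <= / e)%R.
  have -> : 16%R = (/ (1 / 16))%R by field.
  exact: Rinv_le_contravar.
have eie : (e * / e = 1)%R by field; lra.
(* This lower bound absorbs the +1 from rounding the number of questions. *)
have sl_ge : (/ 8 <= s * l)%R.
  have : ((s * l) * (s * l) = M * L)%R by rewrite -ss -ll; ring.
  have : (0 < s * l)%R by exact: Rmult_lt_0_compat.
  have : (/ 2 < M * L)%R by nra.
  by nra.
suff [k [k_le cov]] : exists k,
    (INR k <= 2 ^ 15 * / e * (s * l))%R /\ coverable Y m L e (fun _ _ => True) k.
  by exists k; split=> //; nra.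
(* For small r, m = r s l is itself O(s l / e), so J can be guessed in full; for large r, e r >= 16
   yields the hypothesis [t_small]. *)
case: (Rlt_le_dec r (16 * / e)) => [r_small|r_large].
  exists m.+1; split; last by apply: coverable_all_sets => //; lra.
  rewrite S_INR -/M; have -> : (M = r * (s * l))%R by rewrite -ss -{2}rl; ring.
  nra.
have r_ge1 : (1 <= r)%R by lra.
have [t0 [t_le t_gt]] := @nat_floor r ltac:(lra).
have t0_gt0 : (0 < t0)%N.
  by rewrite lt0n; apply/eqP => t00; move: t_gt; rewrite t00 /=; lra.
have t1 : (1 <= INR t0)%R by have := INR_leq t0_gt0.
have ML : (M = r * r * L)%R by rewrite -ss -ll -rl; ring.
have er : (16 <= e * r)%R.
  have : (e * (16 * / e) <= e * r)%R by apply: Rmult_le_compat_l; lra.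
  by nra.
have t_small : (4 * INR t0 * L <= e * INR m)%R.
  rewrite -/M ML; have : (4 * INR t0 <= e * r * r)%R by nra.
  by nra.
(* The three terms contribute at most 32, 8 and 8 times s l / e. *)
have pot_le : (potential m L e t0 (INR n) 0 <= 2 ^ 14 * / e * (s * l))%R.
  have rL : (r * L = s * l)%R by rewrite -ll -rl; ring.
  have ln_n : (ln (1 + INR n) <= 2 * L)%R by rewrite Rplus_comm -S_INR; exact: ln_succ_le_double.
  have X0 : (0 <= / e * (s * l))%R by nra.
  rewrite /potential -/M Rminus_0_r.
  set a := (8 * (INR t0 + 1) / e)%R.
  have a0 : (0 < a)%R by rewrite /a /Rdiv; nra.
  have aL : (a * L <= 16 * (/ e * (s * l)))%R.
    have -> : (a * L = 8 * / e * ((INR t0 + 1) * L))%R by rewrite /a /Rdiv; ring.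
    rewrite -rL; have : ((INR t0 + 1) * L <= 2 * (r * L))%R by nra.
    by nra.
  have -> : ((a * L / (2 * M) + 4 / (e * INR t0)) * M =
      a * L / 2 + 4 * / e * (M * / INR t0))%R by field; lra.
  have : (M * / INR t0 <= 2 * (s * l))%R.
    apply: (Rmult_le_reg_r (INR t0)); first lra.
    have -> : (M * / INR t0 * INR t0 = r * (r * L))%R by rewrite ML; field; lra.
    by rewrite rL; nra.
  move=> Mt; have : (4 * / e * (M * / INR t0) <= 8 * (/ e * (s * l)))%R by nra.
  have : (a * ln (1 + INR n) <= 2 * (a * L))%R by nra.
  by lra.
have [k [k_le k_gt]] := @nat_floor (2 ^ 14 * / e * (s * l))%R ltac:(nra).
exists k.+1; split; first by rewrite S_INR; nra.
apply: (coverable_weaken (P := fits [::] Y) (k := k.+1)) => //.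
  by move=> J I [sJY _ _ _] _.
apply: (@coverable_potential G Y m L e t0) => //; [lra|lra|].
by rewrite sY S_INR (_ : INR (size [::]) = 0%R) //; lra.
Qed.
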